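(* For each root of unity $\zeta\in\mathbb C$, the invariant $J_M$ of an integral homology sphere $M$, and hence the WRT function $\tau(M)=(\tau_\xi(M))_{\xi}$ ($\xi$ running over all roots of unity), is determined by the power series $\iota_\zeta(J_M)\in\mathbb Z[\zeta][[q-\zeta]]$: if $M,M'$ are integral homology spheres with $\iota_\zeta(J_M)=\iota_\zeta(J_{M'})$, then $J_M=J_{M'}$ and $\tau_\xi(M)=\tau_\xi(M')$ for all roots of unity $\xi$. In particular, $J_M$ is determined by the Ohtsuki series $\tau^O(M)$, and $J_M$ and $\tau^O(M)$ have the same strength in distinguishing integral homology spheres: $J_M=J_{M'}$ if and only if $\tau^O(M)=\tau^O(M')$.
   Context: Integral homology sphere: closed connected oriented 3-manifold with trivial first integral homology. $\widehat{\mathbb Z[q]}=\varprojlim_n\mathbb Z[q]/((q)_n)$ with $(q)_n=(1-q)(1-q^2)\cdots(1-q^n)$. For a root of unity $\zeta$, $\mathrm{ev}_\zeta:\widehat{\mathbb Z[q]}\to\mathbb Z[\zeta]$ is the ring homomorphism induced by $f(q)\mapsto f(\zeta)$, and $\iota_\zeta:\widehat{\mathbb Z[q]}\to\mathbb Z[\zeta][[q-\zeta]]$ is the ring homomorphism induced by the inclusion $\mathbb Z[q]\subset\mathbb Z[\zeta][q]$. $\tau_\zeta(M)$ denotes the $SU(2)$ Witten-Reshetikhin-Turaev (WRT) invariant of $M$ at the root of unity $\zeta$ (normalized by $\tau_\zeta(S^3)=1$, and $\tau_1(M)=1$). $J_M\in\widehat{\mathbb Z[q]}$ denotes the unified WRT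 invariant of integral homology spheres, which satisfies $\mathrm{ev}_\zeta(J_M)=\tau_\zeta(M)$ for every root of unity $\zeta$. Ohtsuki series: $\tau^O(M)\in\mathbb Z[[q-1]]$ is the unique power series such that for every root of unity $\zeta$ of odd prime power order $p^e$, the series $\tau^O(M)|_{q=\zeta}$ converges $p$-adically to $\tau_\zeta(M)$ in $\mathbb Z_p[\zeta]\cong\varprojlim_n\mathbb Z[\zeta]/(p^n)$. *)

(* Defs.v *)
From HB Require Import structures.
From mathcomp Require Import all_boot all_order all_algebra all_field.
From mathcomp Require Import spectral qpoly.
From mathcomp Require Import all_classical all_reals all_analysis.

Set Implicit Arguments.
Unset Strict Implicit.
Unset Printing Implicit Defensive.

Import Order.TTheory GRing.Theory Num.Theory.
Import numFieldNormedType.Exports.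

Local Open Scope classical_set_scope.
Local Open Scope ring_scope.

(** * Closed oriented 3-manifolds *)

Section Smooth.
Context {R : realType}.

Fixpoint Ck_on (k : nat) (U : set 'rV[R]_3) (f : 'rV[R]_3 -> 'rV[R]_3) : Prop :=
  if k is k'.+1 then
    (forall x, U x -> differentiable f x) /\
    (forall v, Ck_on k' U (fun x => 'D_v f x))
  else forall x, U x -> {for x, continuous f}.

Definition smooth_on (U : set 'rV[R]_3) (f : 'rV[R]_3 -> 'rV[R]_3) : Prop :=
  forall k, Ck_on k U f.

(* f is read in the parametrization p: p \o g = f on the part of U that f sends
   into the image of p, with g smooth and orientation preserving there. *)
Definition oriented_wrt (T : Type) (p : 'rV[R]_3 -> T) (U : set 'rV[R]_3)
    (f : 'rV[R]_3 -> T) : Prop :=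
  exists g : 'rV[R]_3 -> 'rV[R]_3,
    let W := U `&` f @^-1` range p in
    smooth_on W g /\
    forall x, W x -> p (g x) = f x /\ 0 < \det ('J g x).

End Smooth.

(* A nonempty compact connected Hausdorff space with a smooth oriented atlas of
   parametrizations by all of R^3.  Second countability follows from
   compactness. *)
Record oriented_3manifold (R : realType) := Oriented3Manifold {
  carrier :> topologicalType;
  atlas : set ('rV[R]_3 -> carrier);
  _ : exists x : carrier, True;
  _ : hausdorff_space carrier;
  _ : compact [set: carrier];
  _ : connected [set: carrier];
  _ : forall x : carrier, exists2 p, atlas p & range p x;
  _ : forall p, atlas p ->
      [/\ continuous p, injective p & forall V, open V -> open (p @` V)];
  _ : forall p q, atlas p -> atlas q -> oriented_wrt q setT p
}.

(** * Singular homology with integral coefficients *)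

Section SingularHomology.
Context {R : realType} {T : topologicalType}.

Definition std_simplex (n : nat) : set 'rV[R]_n.+1 :=
  [set x | (forall i, 0 <= x ord0 i) /\ \sum_i x ord0 i = 1].

(* Inclusion of the face opposite to the i-th vertex. *)
Definition face_map (n : nat) (i : 'I_n.+2) (x : 'rV[R]_n.+1) : 'rV[R]_n.+2 :=
  \row_j (if unlift i j is Some k then x ord0 k else 0).

(* Formal sums of singular n-simplices; only the restriction of a map to the
   standard simplex matters, see chain_coef. *)
Definition formal_sum (n : nat) := seq (int * ('rV[R]_n.+1 -> T)).

Definition is_chain (n : nat) (c : formal_sum n) : Prop :=
  forall t, t \in c -> {within @std_simplex n, continuous t.2}.

Definition chain_coef (n : nat) (c : formal_sum n) (s : 'rV[R]_n.+1 -> T) : int :=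
  \sum_(t <- c | `[< forall x, std_simplex x -> t.2 x = s x >]) t.1.

Definition boundary (n : nat) (c : formal_sum n.+1) : formal_sum n :=
  [seq ((-1) ^+ val i * t.1, t.2 \o @face_map n i) | t <- c, i <- enum 'I_n.+2].

Definition trivial_homologyS (n : nat) : Prop :=
  forall c : formal_sum n.+1, is_chain c -> chain_coef (boundary c) = (fun=> 0) ->
  exists2 d : formal_sum n.+2, is_chain d & chain_coef (boundary d) = chain_coef c.

End SingularHomology.

Record homology_sphere3 (R : realType) := HomologySphere3 {
  manifold :> oriented_3manifold R;
  _ : @trivial_homologyS R manifold 0
}.

(** * Links in R^3 given by grid diagrams *)

(* [:: (x_0, y_0); ...; (x_m, y_m)] stands for the closed rectilinear polygon
   (x_0, y_0) -> (x_0, y_1) -> (x_1, y_1) -> (x_1, y_2) -> ... -> (x_0, y_0).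
   Vertical edges always pass over horizontal ones; every link in R^3 has such a
   diagram. *)
Definition grid_polygon := seq (nat * nat).

Definition vsegs (P : grid_polygon) : seq (nat * (nat * nat)) :=
  [seq (pq.1.1, (pq.1.2, pq.2.2)) | pq <- zip P (rot 1 P)].

Definition hsegs (P : grid_polygon) : seq (nat * (nat * nat)) :=
  [seq (pq.2.2, (pq.1.1, pq.2.1)) | pq <- zip P (rot 1 P)].

Definition between (a : nat) (s : nat * nat) : bool :=
  (minn s.1 s.2 < a < maxn s.1 s.2)%N.

Definition crosses (v h : nat * (nat * nat)) : bool :=
  between v.1 h.2 && between h.1 v.2.

Definition crossing_sign (v h : nat * (nat * nat)) : int :=
  if (v.2.1 < v.2.2)%N == (h.2.1 < h.2.2)%N then -1 else 1.

(* Signed number of crossings of P over Q: the linking number if P and Q are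
   different components, the writhe if P = Q. *)
Definition lk (P Q : grid_polygon) : int :=
  \sum_(v <- vsegs P) \sum_(h <- hsegs Q | crosses v h) crossing_sign v h.

Definition scaled_copy (K a : nat) (P : grid_polygon) : grid_polygon :=
  [seq (K * p.1 + a, K * p.2 + a)%N | p <- P].

(* The framing of P given by pushing it off along the horizontal vector
   (1, 1, 0), which is nowhere tangent to the polygon. *)
Definition diagonal_framing (P : grid_polygon) : int :=
  lk (scaled_copy 2 0 P) (scaled_copy 2 1 P).

Definition grid_link_ok (L : seq grid_polygon) : bool :=
  [&& all (fun P : grid_polygon => 2 <= size P)%N L,
      uniq (unzip1 (flatten L)) & uniq (unzip2 (flatten L))].

(* A framed link: its components with their framing numbers. *)
Definition framed_grid := seq (int * grid_polygon).

Definition framing (D : framed_grid) (i : nat) : int := (nth (0, [::]) D i).1.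
Definition component (D : framed_grid) (i : nat) : grid_polygon :=
  (nth (0, [::]) D i).2.

Definition linking_matrix (D : framed_grid) : 'M[int]_(size D) :=
  \matrix_(i, j) if i == j then framing D i
                 else lk (component D i) (component D j).

(** * The Kauffman bracket *)

Section Bracket.
Variable L : seq grid_polygon.

Let V := flatten [seq vsegs P | P <- L].
Let H := flatten [seq hsegs P | P <- L].

Definition crossings : seq (nat * nat) :=
  [seq (vh.1.1, vh.2.1) | vh <- [seq (v, h) | v <- V, h <- H] & crosses vh.1 vh.2].

Definition grid_bound : nat := (\max_(p <- flatten L) maxn p.1 p.2).+1.

(* (true, x, y) is the unit edge from (x, y) to (x, y + 1), and (false, x, y)
   the unit edge from (x, y) to (x + 1, y). *)
Definition unit_edge : finType := (bool * 'I_grid_bound * 'I_grid_bound)%type.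

Definition covered (e : unit_edge) : bool :=
  let: (b, x, y) := e in
  if b then has (fun v => (v.1 == x :> nat) && (minn v.2.1 v.2.2 <= y < maxn v.2.1 v.2.2)%N) V
  else has (fun h => (h.1 == y :> nat) && (minn h.2.1 h.2.2 <= x < maxn h.2.1 h.2.2)%N) H.

(* The two endpoints of an edge, each with the direction (is it vertical?, is it
   positive?) in which the edge leaves that endpoint. *)
Definition darts (e : unit_edge) : seq ((nat * nat) * (bool * bool)) :=
  let: (b, x, y) := e in
  [:: ((x : nat, y : nat), (b, true));
      (if b then (x : nat, y.+1) else (x.+1, y : nat), (b, false))].

(* S is the list of A-smoothed crossings.  Rotating the (vertical) over-strand
   counterclockwise sweeps the north-west and south-east regions, so that the
   A-smoothing joins north to east and south to west; the other smoothing joins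
   north to west and south to east. *)
Definition joined (S : seq (nat * nat)) : rel unit_edge := fun e e' =>
  [&& covered e, covered e' &
      has (fun d => has (fun d' => (d.1 == d'.1) &&
        ((d.1 \in crossings) ==>
           (d'.2 == (~~ d.2.1, if d.1 \in S then d.2.2 else ~~ d.2.2))))
        (darts e')) (darts e)].

Definition nb_loops (S : seq (nat * nat)) : nat := n_comp (joined S) covered.

(* Normalized to be 1 on the empty link; invariant under regular isotopy. *)
Definition kauffman_bracket (A : algC) : algC :=
  \sum_(m : (size crossings).-tuple bool)
     A ^ ((count id m)%:Z - (count negb m)%:Z)
     * (- A ^+ 2 - A ^- 2) ^+ nb_loops (mask m crossings).

End Bracket.

(* The bracket of a framed link: the framing of each component P of the diagram
   is changed from its writhe lk P P to the prescribed one. *)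
Definition framed_bracket (A : algC) (D : framed_grid) : algC :=
  (\prod_(P <- D) (- A ^+ 3) ^ (P.1 - lk P.2 P.2)) * kauffman_bracket (unzip2 D) A.

(** * The SU(2) Witten-Reshetikhin-Turaev invariant *)

(* Chebyshev polynomials: S_0 = 1, S_1 = X, S_(c+2) = X S_(c+1) - S_c. *)
Fixpoint chebyshev_pair (c : nat) : {poly int} * {poly int} :=
  if c is c'.+1 then
    let: (s, t) := chebyshev_pair c' in (t, 'X * t - s)
  else (1, 'X).

Definition chebyshevS (c : nat) : {poly int} := (chebyshev_pair c).1.

Section SurgeryFormula.
Variables (r : nat) (A : algC) (D : framed_grid).
Let m := size D.

(* Each component i is replaced by k i parallel copies with respect to its
   diagonal framing. *)
Definition cable (k : 'I_m -> nat) : framed_grid :=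
  flatten [seq [seq (diagonal_framing (component D i), scaled_copy r a (component D i))
               | a <- iota 0 (k i)] | i : 'I_m <- enum 'I_m].

(* The bracket of D with diagonal framings and S_(c i) on the i-th component,
   for colours c i < r. *)
Definition coloured_bracket (c : 'I_m -> nat) : algC :=
  \sum_(k : {ffun 'I_m -> 'I_r})
     (\prod_i ((chebyshevS (c i))`_(k i))%:~R) * framed_bracket A (cable (fun i => k i)).

(* The bracket of the zero-framed unknot of colour c, i.e. (-1)^c [c + 1], and
   the effect of a positive twist on colour c. *)
Definition unknot_value (c : nat) : algC :=
  (-1) ^+ c * (A ^+ (2 * c.+1)%N - A ^- (2 * c.+1)%N) / (A ^+ 2 - A ^- 2).
Definition twist (c : nat) : algC := (-1) ^+ c * A ^+ (c * c + 2 * c)%N.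

Definition surgery_sum : algC :=
  \sum_(c : {ffun 'I_m -> 'I_r.-1})
     (\prod_i (unknot_value (c i) *
                twist (c i) ^ (framing D i - diagonal_framing (component D i))))
     * coloured_bracket (fun i => c i).

(* The value of surgery_sum on the unknot with framing e = 1 or e = -1. *)
Definition gauss_sum (e : int) : algC :=
  \sum_(c < r.-1) unknot_value c ^+ 2 * twist c ^ e.

Let spectrum : 'rV[algC]_m :=
  spectral_diag (map_mx (intr : int -> algC) (linking_matrix D)).

Definition surgery_invariant : algC :=
  surgery_sum / (gauss_sum 1 ^+ #|[set i | 0 < spectrum ord0 i]%SET|
                 * gauss_sum (-1) ^+ #|[set i | spectrum ord0 i < 0]%SET|).

End SurgeryFormula.

Section Surgery.
Context {R : realType}.

Definition pt3 (a b c : R) : 'rV[R]_3 := \row_i [:: a; b; c]`_i.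

Definition segment3 (p q : 'rV[R]_3) : set 'rV[R]_3 :=
  [set p + t *: (q - p) | t in `[0, 1]].

(* The polygon in R^3: vertical edges of the diagram lie at height 1, horizontal
   ones at height 0. *)
Definition polygon3 (P : grid_polygon) : set 'rV[R]_3 :=
  [set w | exists2 pq, pq \in zip P (rot 1 P) &
     let: ((x, y), (x', y')) := pq in
     let c (a b : nat) (z : R) := pt3 a%:R b%:R z in
     (segment3 (c x y 0) (c x y 1) `|` segment3 (c x y 1) (c x y' 1) `|`
      segment3 (c x y' 1) (c x y' 0) `|` segment3 (c x y' 0) (c x' y' 0)) w].

Definition euclidean_norm (v : 'rV[R]_3) : R := Num.sqrt (\sum_i v ord0 i ^+ 2).

(* Gauss linking integral of two disjoint closed curves of period 1. *)
Definition gauss_linking (f g : R -> 'rV[R]_3) : R :=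
  (4 * pi)^-1 *
  \int[lebesgue_measure]_(s in `[0, 1]) \int[lebesgue_measure]_(t in `[0, 1])
    (\det (\matrix_(i < 3) ([:: f s - g t; derive1 f s; derive1 g t]`_i : 'rV[R]_3))
     / euclidean_norm (f s - g t) ^+ 3).

(* S^1 x R^2 is parametrized by R^3, with period 1 in the first coordinate. *)
Definition is_tube (phi : 'rV[R]_3 -> 'rV[R]_3) : Prop :=
  [/\ smooth_on setT phi,
      forall x, \det ('J phi x) != 0 &
      forall x y, phi x = phi y <-> exists k : int, y = x + pt3 k%:~R 0 0].

Definition tube_core (T : Type) (phi : 'rV[R]_3 -> T) (t : R) : T :=
  phi (pt3 t 0 0).

(* The cores of the tubes phi_i form a link that is ambient isotopic to the grid
   link D, and the push-off of each core along its tube realizes the framing. *)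
Definition framed_tubes (D : framed_grid)
    (phi : 'I_(size D) -> 'rV[R]_3 -> 'rV[R]_3) : Prop :=
  [/\ forall i, is_tube (phi i),
      forall i j, i != j -> range (phi i) `&` range (phi j) = set0,
      exists H : R -> 'rV[R]_3 -> 'rV[R]_3,
        [/\ continuous (fun p : R * 'rV[R]_3 => H p.1 p.2),
            forall t, bijective (H t), H 0 = id &
            forall i, H 1 @` range (tube_core (phi i)) = polygon3 (component D i)] &
      forall i, gauss_linking (tube_core (phi i)) (fun t => phi i (pt3 t 1 0))
                = (framing D i)%:~R].

Definition link_complement (m : nat) (phi : 'I_m -> 'rV[R]_3 -> 'rV[R]_3) :
    set 'rV[R]_3 := [set x | forall i t, tube_core (phi i) t <> x].

(* M is the result of surgery on S^3 along the framed link D: psi embeds the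
   complement of the link in R^3, chi_i is the solid torus glued in place of the
   i-th component, with meridian disks bounded by the push-offs, and the one
   remaining point of M is the point at infinity of S^3. *)
Definition surgery_presentation (M : oriented_3manifold R) (D : framed_grid) :
    Prop :=
  grid_link_ok (unzip2 D) /\
  exists (phi : 'I_(size D) -> 'rV[R]_3 -> 'rV[R]_3) (psi : 'rV[R]_3 -> M)
         (chi : 'I_(size D) -> 'rV[R]_3 -> M) (infty : M),
  let U := link_complement phi in
  [/\ framed_tubes phi,
      [/\ forall x, U x -> {for x, continuous psi}, set_inj U psi &
          forall p, atlas p -> oriented_wrt p U psi],
      [/\ forall i, continuous (chi i),
          forall i a b s, 0 < s ->
            chi i (pt3 b (s * cos (2 * pi * a)) (s * sin (2 * pi * a))) =
            psi (phi i (pt3 a (s * cos (2 * pi * b)) (s * sin (2 * pi * b)))) &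
          forall i j b b', tube_core (chi i) b = tube_core (chi j) b' <->
            i = j /\ exists k : int, b' = b + k%:~R],
      forall i b x, U x -> tube_core (chi i) b <> psi x &
      ~` (psi @` U `|` \bigcup_i range (tube_core (chi i))) = [set infty]].

(* tau_z(M) for a homology sphere M and a primitive r-th root of unity z.  Every
   M has a surgery presentation, and the value depends neither on it nor on the
   choice of a fourth root A of z of order 4r.  A framing change by +1 acts on the
   n-dimensional representation by A^(n^2 - 1) up to sign, as in the conventions
   for which the series at z = 1 starts with 1 + 6 lambda(M) (q - 1), lambda being
   the Casson invariant. *)
Definition wrt (M : oriented_3manifold R) (r : nat) (z : algC) : algC :=
  if (r <= 1)%N then 1 else
  surgery_invariant r
    (xget 0 [set A : algC | (4 * r)%N.-primitive_root A /\ A ^+ 4 = z])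
    (xget [::] [set D | surgery_presentation M D]).

End Surgery.

(** * The completion of Z[q] *)

Local Notation pZtoC := (map_poly (intr : int -> algC)).

(* (q)_n up to sign, so as to be monic. *)
Definition qpoch (n : nat) : {poly int} := \prod_(1 <= i < n.+1) ('X^i - 1).

(* {poly %/ p} is the quotient by p only if p is monic and non-constant. *)
Fact mk_monic_qpoch (n : nat) : mk_monic (qpoch n.+1) = qpoch n.+1.
Proof.
have monX i : ('X^(i.+1) - 1 : {poly int}) \is monic.
  by rewrite -polyC1; exact: monicXnsubC.
have monP (F : seq nat) : \prod_(i <- F) ('X^(i.+1) - 1 : {poly int}) \is monic.
  exact: monic_prod.
rewrite /mk_monic /qpoch big_add1 monP andbT ifT // big_nat_recl //.
have monQ : \prod_(0 <= i < n) ('X^(i.+2) - 1 : {poly int}) \is monic.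
  exact: monic_prod.
rewrite size_monicM ?monic_neq0 // -polyC1 size_XnsubC //.
by rewrite !addSn add0n ltnS size_poly_gt0 polyC1 monic_neq0.
Qed.

(* The inverse limit of the rings Z[q]/((q)_n) for n > 0 (the ring at n = 0 is
   zero); level f n is the component of f in Z[q]/((q)_(n+1)). *)
Record habiro_ring := HabiroRing {
  level : forall n, {poly %/ qpoch n.+1};
  _ : forall n, level n = in_qpoly (qpoch n.+1) (level n.+1 : {poly int})
}.

(* Evaluation at a primitive r-th root of unity z, at which (q)_(r+1) vanishes. *)
Definition ev (r : nat) (z : algC) (f : habiro_ring) : algC :=
  (pZtoC (level f r)).[z].

(* Coefficients of the image of f in Z[z][[q - z]], for z a primitive r-th root
   of unity: (q - z)^(k+1) divides (q)_((k+1)r). *)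
Definition iota_series (r : nat) (z : algC) (f : habiro_ring) : nat -> algC :=
  fun k => (pZtoC (level f (k.+1 * r)%N) \Po ('X + z%:P))`_k.

(** * The unified WRT invariant and the Ohtsuki series *)

Definition is_unified_wrt (R : realType) (M : homology_sphere3 R)
    (J : habiro_ring) : Prop :=
  forall r z, r.-primitive_root z -> ev r z J = wrt M r z.

(* x \in p^n Z[z] *)
Definition in_pnZ (p n : nat) (z x : algC) : Prop :=
  exists g : {poly int}, x = (p ^ n)%N%:R * (pZtoC g).[z].

(* The coefficients of a power series in q - 1. *)
Definition is_ohtsuki_series (R : realType) (M : homology_sphere3 R)
    (P : nat -> int) : Prop :=
  forall p e z, prime p -> odd p -> (0 < e)%N -> (p ^ e)%N.-primitive_root z ->
  forall n, exists N, forall m, (N <= m)%N ->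
    in_pnZ p n z (\sum_(k < m) (P k)%:~R * (z - 1) ^+ k - wrt M (p ^ e) z).

Definition ohtsuki (R : realType) (M : homology_sphere3 R) : nat -> int :=
  xget (fun=> 0) [set P | is_ohtsuki_series M P].

(* Main.v *)
(* An element of the completion is a coherent sequence f of integer polynomials;
   its expansion at the primitive n-th roots of unity vanishes iff every power of
   Phi_n divides f N for N large.  If p is prime and m = n p or n = m p, the value
   of Phi_n at a primitive m-th root of unity z is nilpotent modulo p in Z[z], by
   the congruence Phi_n(q^p) = Phi_n(q)^p mod p.  Hence, if the expansion vanishes
   at order n but not at order m, its leading coefficient at z is divisible by all
   powers of p, which is absurd.  Multiplying and dividing by primes connects all
   positive integers, so that one vanishing expansion makes all of them vanish;
   as (q)_n is a product of cyclotomic polynomials, f is then zero.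

   The Ohtsuki series is the expansion of J at 1: that expansion converges
   p-adically to ev_z(J) because z - 1 is nilpotent modulo p when z has order p^e,
   and the series is unique because the first nonzero coefficient of a difference
   of two of them would be divisible by every odd prime. *)

Require Import Defs.
From mathcomp Require Import all_boot all_order all_algebra all_field.
From mathcomp Require Import all_classical all_reals all_analysis.
From mathcomp Require Import qpoly.
From mathcomp Require Import ring.

Set Implicit Arguments.
Unset Strict Implicit.
Unset Printing Implicit Defensive.

Import GRing.Theory Num.Theory.
Import Pdiv.CommonRing.

Local Open Scope ring_scope.

Local Notation pZtoC := (map_poly (intr : int -> algC)).

(** * Divisibility in a commutative ring *)

Definition divides (R : comNzRingType) (d x : R) := exists y, x = d * y.

Section Divides.
Variable R : comNzRingType.
Implicit Types d x y : R.

Lemma dividesxx x : divides x x.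
Proof. by exists 1; rewrite mulr1. Qed.

Lemma divides0 d : divides d 0.
Proof. by exists 0; rewrite mulr0. Qed.

Lemma divides_mulr d x y : divides d x -> divides d (x * y).
Proof. by case=> u ->; exists (u * y); rewrite mulrA. Qed.

Lemma divides_mull d x y : divides d x -> divides d (y * x).
Proof. by rewrite mulrC; apply: divides_mulr. Qed.

Lemma dividesM d e x y : divides d x -> divides e y -> divides (d * e) (x * y).
Proof. by case=> u -> [v ->]; exists (u * v); rewrite mulrACA. Qed.

Lemma divides_exp2l d m n : (m <= n)%N -> divides (d ^+ m) (d ^+ n).
Proof. by move=> le_mn; exists (d ^+ (n - m)); rewrite -exprD subnKC. Qed.

Lemma dividesD d x y : divides d x -> divides d y -> divides d (x + y).
Proof. by case=> u -> [v ->]; exists (u + v); rewrite mulrDr. Qed.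

Lemma dividesN d x : divides d x -> divides d (- x).
Proof. by case=> u ->; exists (- u); rewrite mulrN. Qed.

Lemma dividesB d x y : divides d x -> divides d y -> divides d (x - y).
Proof. by move=> dx dy; apply: dividesD => //; apply: dividesN. Qed.

Lemma divides_trans d x y : divides d x -> divides x y -> divides d y.
Proof. by move=> dx [u ->]; apply: divides_mulr. Qed.

Lemma divides_prod (I : eqType) (s : seq I) (F : I -> R) i :
  i \in s -> divides (F i) (\prod_(j <- s) F j).
Proof.
elim: s => // j s IHs; rewrite in_cons big_cons => /predU1P[-> | /IHs].
  exact/divides_mulr/dividesxx.
exact: divides_mull.
Qed.

End Divides.

(** * Congruences modulo a prime in $\mathbb Z[q]$ *)

Lemma divides_Fp0 (p : nat) (g : {poly int}) : prime p ->
  map_poly (intr : int -> 'F_p) g = 0 -> divides p%:R g.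
Proof.
move=> p_pr g0; exists (map_poly (fun c => (c %/ p)%Z) g).
apply/polyP => i; rewrite mulr_natl coefMn coef_map_id0 ?div0z //.
have: (map_poly (intr : int -> 'F_p) g)`_i = 0 by rewrite g0 coef0.
rewrite coef_map /= => /eqP gi0; rewrite -mulr_natl natz mulrC divzK //.
by rewrite (dvdz_pcharf (pchar_Fp p_pr)) gi0.
Qed.

(** In characteristic $p$ the Frobenius map is additive and fixes the prime field, so Horner
    induction on [g] goes through. *)
Lemma comp_polyXp_modp (p : nat) (g : {poly int}) : prime p ->
  divides p%:R (g \Po 'X^p - g ^+ p).
Proof.
move=> p_pr; apply: divides_Fp0 => //; rewrite rmorphB rmorphXn /=.
have chp : p \in [pchar {poly 'F_p}] by rewrite pchar_poly pchar_Fp.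
apply/eqP; rewrite subr_eq0; apply/eqP.
elim/poly_ind: g => [|g c IHg].
  by rewrite comp_poly0 !rmorph0 expr0n eqn0Ngt prime_gt0.
rewrite comp_polyD comp_polyM comp_polyX comp_polyC !rmorphD !rmorphM /= IHg.
rewrite exprDn_pchar; last by rewrite pnatE.
rewrite exprMn map_polyX map_polyXn; congr (_ + _).
rewrite map_polyC /= -[RHS](pFrobenius_autE chp).
by have -> : polyC (c%:~R : 'F_p) = c%:~R; rewrite ?pFrobenius_aut_int ?rmorph_int.
Qed.

Lemma XsubC1_expp_modp (p e : nat) : prime p -> odd p ->
  divides p%:R (('X - 1 : {poly int}) ^+ (p ^ e)%N - ('X^(p ^ e)%N - 1)).
Proof.
move=> p_pr p_odd; apply: divides_Fp0 => //.
have chp : p \in [pchar {poly 'F_p}] by rewrite pchar_poly pchar_Fp.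
rewrite !(rmorphB, rmorphXn, rmorph1) /= map_polyX.
rewrite exprDn_pchar; last by rewrite pnatX pnatE // chp.
(* Oddness of $p$ gives $(-1)^{p^e}=-1$. *)
by rewrite -signr_odd oddX p_odd orbT expr1 subrr.
Qed.

(** * Values of integer polynomials at roots of unity *)

Lemma horner_pZtoCD z g h : (pZtoC (g + h)).[z] = (pZtoC g).[z] + (pZtoC h).[z].
Proof. by rewrite rmorphD hornerD. Qed.

Lemma horner_pZtoCN z g : (pZtoC (- g)).[z] = - (pZtoC g).[z].
Proof. by rewrite rmorphN hornerN. Qed.

Lemma horner_pZtoCM z g h : (pZtoC (g * h)).[z] = (pZtoC g).[z] * (pZtoC h).[z].
Proof. by rewrite rmorphM hornerM. Qed.

Lemma horner_pZtoCX z g n : (pZtoC (g ^+ n)).[z] = (pZtoC g).[z] ^+ n.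
Proof. by rewrite rmorphXn horner_exp. Qed.

Lemma horner_pZtoC_nat z n : (pZtoC n%:R).[z] = n%:R.
Proof. by rewrite rmorph_nat hornerMn hornerC. Qed.

Lemma horner_pZtoC_C z c : (pZtoC c%:P).[z] = c%:~R.
Proof. by rewrite map_polyC hornerC. Qed.

Lemma horner_pZtoC_1 z : (pZtoC 1).[z] = 1.
Proof. by rewrite rmorph1 hornerC. Qed.

Lemma horner_pZtoC_X z : (pZtoC 'X).[z] = z.
Proof. by rewrite map_polyX hornerX. Qed.

Lemma horner_pZtoC_comp z g h : (pZtoC (g \Po h)).[z] = (pZtoC g).[(pZtoC h).[z]].
Proof. by rewrite map_comp_poly horner_comp. Qed.

Definition horner_pZtoCE := (horner_pZtoCD, horner_pZtoCN, horner_pZtoCM,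
  horner_pZtoC_C, horner_pZtoC_1, horner_pZtoC_X,
  horner_pZtoCX, horner_pZtoC_nat).

Lemma Cyclotomic1 : 'Phi_1 = 'X - 1.
Proof. by rewrite -['X]expr1 -prod_Cyclotomic // big_seq1. Qed.

Lemma Cyclotomic_root n z : n.-primitive_root z -> (pZtoC 'Phi_n).[z] = 0.
Proof.
move=> prim_z; rewrite (Cintr_Cyclotomic prim_z); apply/rootP.
by rewrite root_cyclotomic.
Qed.

Lemma Cyclotomic_root_neq0 m n z :
  m.-primitive_root z -> (0 < n)%N -> m != n -> (pZtoC 'Phi_n).[z] != 0.
Proof.
move=> prim_z n_gt0 neq_mn; have [w prim_w] := C_prim_root_exists n_gt0.
rewrite (Cintr_Cyclotomic prim_w); apply/negP => /eqP/rootP.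
rewrite root_cyclotomic // => prim_z'; case/negP: neq_mn.
rewrite eqn_dvd (prim_order_dvd prim_z) (prim_order_dvd prim_z').
by rewrite !prim_expr_order ?eqxx.
Qed.

(** $\Phi_n$ is the minimal polynomial of $z$ over $\mathbb Q$, so a nonzero polynomial vanishing at
    $z$ has at least its degree. *)
Lemma horner_Cyclotomic_small n z (g : {poly int}) : n.-primitive_root z ->
  (pZtoC g).[z] = 0 -> (size g < size 'Phi_n)%N -> g = 0.
Proof.
move=> prim_z gz0 sz_g.
have intC_inj : injective (intr : int -> algC) by exact: intr_inj.
apply: (map_inj_poly intC_inj); rewrite // rmorph0.
apply/eqP; apply: contraTT sz_g => g_neq0; rewrite -leqNgt.
have ratE : pZtoC g = map_poly ratr (map_poly intr g : {poly rat}).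
  by rewrite -map_poly_comp; apply: eq_map_poly => c; rewrite /= ratr_int.
have /dvdp_leq : minCpoly z %| pZtoC g.
  have [p [pE _ p_min]] := minCpolyP z.
  by rewrite pE ratE dvdp_map -p_min -ratE; apply/rootP.
rewrite g_neq0 => /(_ isT); rewrite (minCpoly_cyclotomic prim_z).
by rewrite -(Cintr_Cyclotomic prim_z) !size_map_inj_poly.
Qed.

(** As $\Phi_n$ is monic, the division takes place over $\mathbb Z$; the remainder vanishes at $z$
    and is too small to be nonzero. *)
Lemma horner_Cyclotomic_divides n z (g : {poly int}) : n.-primitive_root z ->
  (pZtoC g).[z] = 0 -> divides 'Phi_n g.
Proof.
move=> prim_z gz0; have monP := Cyclotomic_monic n.
exists (rdivp g 'Phi_n); rewrite {1}(Pdiv.RingMonic.rdivp_eq monP g) mulrC.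
suff -> : rmodp g 'Phi_n = 0 by rewrite addr0.
apply: (horner_Cyclotomic_small prim_z); last by rewrite ltn_rmodpN0 ?monic_neq0.
move: gz0; rewrite {1}(Pdiv.RingMonic.rdivp_eq monP g) !horner_pZtoCE.
by rewrite Cyclotomic_root // mulr0 add0r.
Qed.

Lemma divides_horner_Cyclotomic n z (g : {poly int}) : n.-primitive_root z ->
  divides 'Phi_n g -> (pZtoC g).[z] = 0.
Proof.
by move=> prim_z [h ->]; rewrite horner_pZtoCM Cyclotomic_root // mul0r.
Qed.

(* Z[z] is free over Z, on the powers of z below the degree of Phi_n. *)
Lemma in_pnZ_bigcap n z (p : nat) (x : algC) : n.-primitive_root z ->
  (1 < p)%N -> (forall k, in_pnZ p k z x) -> x = 0.
Proof.
move=> prim_z p_gt1 x_div; have monP := Cyclotomic_monic n.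
have red (g : {poly int}) : exists2 h : {poly int},
    (size h < size 'Phi_n)%N & (pZtoC g).[z] = (pZtoC h).[z].
  exists (rmodp g 'Phi_n); first by rewrite ltn_rmodpN0 ?monic_neq0.
  rewrite {1}(Pdiv.RingMonic.rdivp_eq monP g) !horner_pZtoCE.
  by rewrite Cyclotomic_root // mulr0 add0r.
have x_red k : exists2 h : {poly int},
    (size h < size 'Phi_n)%N & x = (p ^ k)%:R * (pZtoC h).[z].
  by have [g ->] := x_div k; have [h sz_h ->] := red g; exists h.
have [g sz_g xE] := x_red 0; rewrite expn0 mul1r in xE.
suff g0 : g = 0 by rewrite xE g0 rmorph0 horner0.
apply/polyP => i; rewrite coef0.
(* The exponent $|g_i|$ is chosen because $p^{|g_i|}>|g_i|$: a coefficient divisible by that power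
   must vanish. *)
have [h sz_h hE] := x_red (absz g`_i).
have gE : g = (p ^ absz g`_i)%:R * h.
  apply/eqP; rewrite -subr_eq0; apply/eqP.
  apply: (horner_Cyclotomic_small prim_z).
    by rewrite !horner_pZtoCE -xE -hE subrr.
  rewrite (leq_ltn_trans (size_polyD _ _)) // gtn_max sz_g size_polyN.
  by rewrite mulr_natl -scaler_nat (leq_ltn_trans (size_scale_leq _ _)).
move: (congr1 (fun q : {poly int} => absz q`_i) gE) => /=.
rewrite mulr_natl coefMn -mulr_natl abszM natz absz_nat.
case: (posnP (absz h`_i)) => [-> | hi_gt0 gi].
  by rewrite muln0 => /eqP; rewrite absz_eq0 => /eqP.
have := ltn_expl (absz g`_i) p_gt1.
by rewrite ltnNge {2}gi leq_pmulr.
Qed.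

(** * The polynomials $\Phi_n(q^p)$ *)

Lemma totient_mul_prime (p n : nat) : prime p -> (0 < n)%N -> (p %| n)%N ->
  totient (n * p) = (totient n * p)%N.
Proof.
move=> p_pr n_gt0 p_dvd_n.
have [m co_pm nE] := pfactor_coprime p_pr n_gt0.
have e_gt0 : (0 < logn p n)%N by rewrite logn_gt0 mem_primes p_pr n_gt0.
have co k : coprime m (p ^ k) by rewrite coprime_sym coprimeXl.
rewrite {1 2}nE -mulnA -expnSr !totient_coprime // !totient_pfactor //=.
by rewrite -{1}(prednK e_gt0) expnSr !mulnA.
Qed.

Lemma monic_divides_eq (R : idomainType) (d g : {poly R}) : d \is monic ->
  g \is monic -> size g = size d -> divides d g -> g = d.
Proof.
move=> d_mon g_mon sz_g [u gE]; have u_mon : u \is monic.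
  by rewrite -(monicMr _ d_mon) mulrC -gE.
move: sz_g; rewrite gE size_Mmonic ?monic_neq0 // => sz_du.
suff -> : u = 1 by rewrite mulr1.
have sz_u : (size u <= 1)%N.
  have : (0 < size d)%N by rewrite size_poly_gt0 monic_neq0.
  by move: sz_du; case: (size d) => // a; rewrite addSn /= -addn1 => /addnI ->.
move: u_mon; rewrite (size1_polyC sz_u) monicE lead_coefC.
by move/eqP->.
Qed.

Lemma monic_divides_small (R : idomainType) (d g : {poly R}) : d \is monic ->
  divides d g -> (size g < size d)%N -> g = 0.
Proof.
move=> d_mon [u ->] lt_du; apply/eqP; apply: contraTT lt_du => du_neq0.
have u_neq0 : u != 0 by apply: contraNneq du_neq0 => ->; rewrite mulr0.
rewrite -size_poly_gt0 in u_neq0.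
rewrite -leqNgt mulrC size_Mmonic -?size_poly_gt0 //.
by rewrite -(prednK u_neq0) addSn leq_addl.
Qed.

Lemma comp_polyXn_monic (g : {poly int}) p : (0 < p)%N -> g \is monic ->
  g \Po 'X^p \is monic.
Proof.
move=> p_gt0 g_mon; rewrite monicE lead_coef_comp ?size_polyXn //.
by rewrite lead_coefXn expr1n mulr1.
Qed.

Lemma size_comp_Cyclotomic n p : (0 < p)%N ->
  size ('Phi_n \Po 'X^p) = (totient n * p).+1.
Proof.
move=> p_gt0; have := size_comp_poly 'Phi_n ('X^p : {poly int}).
rewrite size_Cyclotomic size_polyXn /= => <-.
rewrite prednK // size_poly_gt0 monic_neq0 //.
exact/comp_polyXn_monic/Cyclotomic_monic.
Qed.

(** If $z$ has order $np$, then $z^p$ has order $n$. *)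
Lemma Cyclotomic_divides_comp n p : (0 < n)%N -> (0 < p)%N ->
  divides 'Phi_(n * p) ('Phi_n \Po 'X^p).
Proof.
move=> n_gt0 p_gt0; have np_gt0 : (0 < n * p)%N by rewrite muln_gt0 n_gt0.
have [z prim_z] := C_prim_root_exists np_gt0.
apply: (horner_Cyclotomic_divides prim_z).
rewrite horner_pZtoC_comp !horner_pZtoCE Cyclotomic_root //.
have := dvdn_prim_root prim_z (dvdn_mulr p (dvdnn n)).
by rewrite mulKn.
Qed.

Lemma comp_Cyclotomic_dvd (p n : nat) : prime p -> (0 < n)%N -> (p %| n)%N ->
  'Phi_n \Po 'X^p = 'Phi_(n * p).
Proof.
move=> p_pr n_gt0 p_dvd_n; have p_gt0 := prime_gt0 p_pr.
apply: monic_divides_eq; rewrite ?Cyclotomic_monic //.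
- exact/comp_polyXn_monic/Cyclotomic_monic.
- by rewrite size_comp_Cyclotomic // size_Cyclotomic totient_mul_prime.
- exact: Cyclotomic_divides_comp.
Qed.

(** As $p$ is prime to $n$, a root $z$ of $\Phi_n$ has $z^p$ of order $n$ too, which yields the
    second factor; the degrees then match. *)
Lemma comp_Cyclotomic_ndvd (p n : nat) :
  prime p -> (0 < n)%N -> ~~ (p %| n)%N ->
  'Phi_n \Po 'X^p = 'Phi_(n * p) * 'Phi_n.
Proof.
move=> p_pr n_gt0 p_ndvd_n; have p_gt0 := prime_gt0 p_pr.
have co_np : coprime n p by rewrite coprime_sym prime_coprime.
have [z prim_z] := C_prim_root_exists n_gt0.
apply: monic_divides_eq.
- by rewrite rpredM ?Cyclotomic_monic.
- exact/comp_polyXn_monic/Cyclotomic_monic.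
- rewrite size_comp_Cyclotomic // size_Mmonic ?monic_neq0 ?Cyclotomic_monic //.
  rewrite !size_Cyclotomic addnS /= addSn totient_coprime // (totient_prime p_pr).
  by have := mulnSr (totient n) p.-1; rewrite prednK // => ->; rewrite addnC.
have [u uE] := Cyclotomic_divides_comp n_gt0 p_gt0.
rewrite uE; suff [v ->] : divides 'Phi_n u by exists v; rewrite mulrA.
apply: (horner_Cyclotomic_divides prim_z).
have : (pZtoC ('Phi_n \Po 'X^p)).[z] = 0.
  rewrite horner_pZtoC_comp !horner_pZtoCE Cyclotomic_root //.
  by rewrite prim_root_exp_coprime // coprime_sym.
have z_neq0 : (pZtoC 'Phi_(n * p)).[z] != 0.
  apply: (Cyclotomic_root_neq0 prim_z); first by rewrite muln_gt0 n_gt0.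
  by rewrite -{1}[n]muln1 eqn_pmul2l // neq_ltn prime_gt1.
by rewrite uE horner_pZtoCM => /eqP; rewrite mulf_eq0 (negPf z_neq0) => /eqP.
Qed.

(** * Nilpotence of $\Phi_n(z)$ modulo $p$ at neighbouring orders *)

Definition nilpotent_mod (p n m : nat) := forall z : algC,
  m.-primitive_root z -> in_pnZ p 1 z ((pZtoC 'Phi_n).[z] ^+ p).

(** By the Frobenius congruence, $\Phi_n(z)^p\equiv\Phi_n(z^p)=0$ modulo $p$. *)
Lemma nilpotent_mod_up (p n : nat) : prime p -> (0 < n)%N ->
  nilpotent_mod p n (n * p).
Proof.
move=> p_pr n_gt0 z prim_z.
have [h hE] := comp_polyXp_modp 'Phi_n p_pr.
have [u uE] := Cyclotomic_divides_comp n_gt0 (prime_gt0 p_pr).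
exists (- h); rewrite expn1 -horner_pZtoCX.
have -> : 'Phi_n ^+ p = 'Phi_(n * p) * u - p%:R * h.
  by rewrite -uE -hE opprB addrC subrK.
by rewrite !horner_pZtoCE (Cyclotomic_root prim_z) mul0r add0r mulrN.
Qed.

(** In this direction $\Phi_{np}(z)$ is itself a multiple of $p$; its $p$-th power only matches the
    form used upward. *)
Lemma nilpotent_mod_down (p n : nat) : prime p -> (0 < n)%N ->
  nilpotent_mod p (n * p) n.
Proof.
move=> p_pr n_gt0 z prim_z; have p_gt1 := prime_gt1 p_pr.
suff [g gE] : exists g : {poly int},
    (pZtoC 'Phi_(n * p)).[z] = p%:R * (pZtoC g).[z].
  exists (g * 'Phi_(n * p) ^+ p.-1).
  rewrite expn1 -[X in _ ^+ X = _](prednK (prime_gt0 p_pr)).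
  by rewrite exprS !horner_pZtoCE {1}gE mulrA.
have [h /(canRL (subrK _)) hE] := comp_polyXp_modp 'Phi_n p_pr.
have := congr1 (fun q => (pZtoC q).[z]) hE.
rewrite !horner_pZtoCE (Cyclotomic_root prim_z) expr0n eqn0Ngt prime_gt0 // addr0.
case: (boolP (p %| n)%N) => [p_dvd_n | p_ndvd_n].
  by rewrite comp_Cyclotomic_dvd //; exists h.
(* At $z$ the relation $\Phi_{np}\Phi_n=ph+\Phi_n^p$ only says $h(z)=0$. Hence $\Phi_n$ divides $h$,
   and dividing it out leaves a relation that gives $\Phi_{np}(z)$ modulo $p$. *)
rewrite comp_Cyclotomic_ndvd // in hE *.
rewrite horner_pZtoCM (Cyclotomic_root prim_z) mulr0 => /esym/eqP.
rewrite mulf_eq0 pnatr_eq0 eqn0Ngt prime_gt0 //= => /eqP.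
case/(horner_Cyclotomic_divides prim_z) => g gE.
exists g; have -> : 'Phi_(n * p) = p%:R * g + 'Phi_n ^+ p.-1.
  apply: (mulIf (monic_neq0 (Cyclotomic_monic n))).
  by rewrite hE gE mulrDl -exprSr prednK ?prime_gt0 // -mulrA (mulrC g).
rewrite !horner_pZtoCE (Cyclotomic_root prim_z) expr0n.
by rewrite -subn1 subn_eq0 leqNgt p_gt1 addr0.
Qed.

(** * Divisibility by products of cyclotomic polynomials *)

Lemma divides_Cyclotomic_exp_cancel n z (u g : {poly int}) k :
  n.-primitive_root z -> (pZtoC u).[z] != 0 ->
  divides ('Phi_n ^+ k) (u * g) -> divides ('Phi_n ^+ k) g.
Proof.
move=> prim_z uz_neq0; elim: k g => [|k IHk] g [w wE].
  by exists g; rewrite expr0 mul1r.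
have [h hE] : divides 'Phi_n g.
  apply: (horner_Cyclotomic_divides prim_z).
  move: (congr1 (fun q => (pZtoC q).[z]) wE).
  rewrite exprS !horner_pZtoCE (Cyclotomic_root prim_z) !mul0r => /eqP.
  by rewrite mulf_eq0 (negPf uz_neq0) => /eqP.
rewrite hE exprS; apply: dividesM; first exact: dividesxx.
apply: IHk; exists w; apply: (mulfI (monic_neq0 (Cyclotomic_monic n))).
by rewrite mulrCA -hE wE exprS -mulrA.
Qed.

(** Distinct cyclotomic polynomials have no common root, so once one $\Phi_b$ is split off, the
    powers of the others still divide the quotient. *)
Lemma divides_prod_Cyclotomic (s : seq nat) (g : {poly int}) :
  {in s, forall a, 0 < a}%N ->
  {in s, forall a, divides ('Phi_a ^+ count_mem a s) g} ->
  divides (\prod_(a <- s) 'Phi_a) g.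
Proof.
elim: s g => [|b s IHs] g s_gt0 s_div.
  by rewrite big_nil; exists g; rewrite mul1r.
rewrite big_cons; have b_gt0 : (0 < b)%N by apply: s_gt0; exact: mem_head.
have [h gE] : divides 'Phi_b g.
  apply: divides_trans (s_div b (mem_head _ _)).
  by rewrite /= eqxx exprS; apply/divides_mulr/dividesxx.
rewrite gE; apply: dividesM; first exact: dividesxx.
apply: IHs => a a_s; first by apply: s_gt0; rewrite in_cons a_s orbT.
have := s_div a; rewrite in_cons a_s orbT => /(_ isT) /=.
have [<- | neq_ba] := eqVneq b a; rewrite ?add0n gE.
  case=> w; rewrite exprS -mulrA => /(mulfI (monic_neq0 (Cyclotomic_monic b))) ->.
  exact/divides_mulr/dividesxx.
have a_gt0 : (0 < a)%N by apply: s_gt0; rewrite in_cons a_s orbT.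
have [z prim_z] := C_prim_root_exists a_gt0.
apply: (divides_Cyclotomic_exp_cancel prim_z).
by apply: (Cyclotomic_root_neq0 prim_z); rewrite // eq_sym.
Qed.

(** * The products $(q)_n$ and coherent sequences *)

Lemma qpochS n : qpoch n.+1 = qpoch n * ('X^(n.+1) - 1).
Proof. by rewrite /qpoch big_nat_recr. Qed.

Lemma qpoch_divides m n : (m <= n)%N -> divides (qpoch m) (qpoch n).
Proof.
move/subnKC <-; elim: (n - m)%N => [|k IHk].
  by rewrite addn0; exact: dividesxx.
by rewrite addnS qpochS; apply: divides_mulr.
Qed.

Lemma qpoch_monic n : qpoch n \is monic.
Proof.
elim: n => [|n IHn]; first by rewrite /qpoch big_geq // monic1.
by rewrite qpochS rpredM // -polyC1 monicXnsubC.
Qed.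

(** Each factor $q^{im}-1$ with $1\le i\le k$ contributes one $\Phi_m$. *)
Lemma Cyclotomic_exp_divides_qpoch m k n : (0 < m)%N -> (k * m <= n)%N ->
  divides ('Phi_m ^+ k) (qpoch n).
Proof.
move=> m_gt0 le_km_n; apply: divides_trans (qpoch_divides le_km_n).
elim: k {n le_km_n} => [|k IHk].
  by rewrite expr0 mul0n; exists (qpoch 0); rewrite mul1r.
have km_gt0 : (0 < k.+1 * m)%N by rewrite muln_gt0.
apply: (@divides_trans _ _ (qpoch (k.+1 * m).-1.+1)); last first.
  by rewrite prednK //; exact: dividesxx.
rewrite qpochS exprSr; apply: dividesM.
  apply: divides_trans IHk _; apply: qpoch_divides.
  by rewrite mulSn -(prednK m_gt0) addSn leq_addl.
rewrite prednK // -prod_Cyclotomic //; apply: (@divides_prod _ _ _ Cyclotomic).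
by rewrite -dvdn_divisors // dvdn_mull.
Qed.

Lemma qpoch_prod_Cyclotomic n : exists2 s : seq nat,
  {in s, forall a, 0 < a}%N & qpoch n = \prod_(a <- s) 'Phi_a.
Proof.
elim: n => [|n [s s_gt0 sE]].
  by exists [::] => //; rewrite /qpoch big_geq ?big_nil.
exists (s ++ divisors n.+1); last by rewrite big_cat /= -sE prod_Cyclotomic ?qpochS.
move=> a; rewrite mem_cat => /orP[/s_gt0 // |].
by rewrite -dvdn_divisors // => /dvdn_gt0; apply.
Qed.

(* A sequence of polynomials representing an element of the completion of Z[q]. *)
Definition coherent (f : nat -> {poly int}) :=
  forall n, divides (qpoch n.+1) (f n.+1 - f n).

Lemma coherent_divides f m n : coherent f -> (m <= n)%N ->
  divides (qpoch m.+1) (f n - f m).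
Proof.
move=> f_coh /subnKC <-; elim: (n - m)%N => [|k IHk].
  by rewrite addn0 subrr; exact: divides0.
rewrite addnS -(subrK (f (m + k)%N) (f _.+1)) -addrA; apply: dividesD => //.
by apply: divides_trans (f_coh _); apply: qpoch_divides; rewrite ltnS leq_addr.
Qed.

(** To any fixed precision, the expansion at roots of order $m$ can thus be read off a single term
    of the sequence. *)
Lemma coherent_Cyclotomic_exp f m k n n' : coherent f -> (0 < m)%N ->
  (k * m <= n.+1)%N -> (n <= n')%N -> divides ('Phi_m ^+ k) (f n' - f n).
Proof.
move=> f_coh m_gt0 le_km le_nn'; apply: divides_trans (coherent_divides f_coh le_nn').
exact: Cyclotomic_exp_divides_qpoch.
Qed.

(** * Vanishing of expansions and its spread to all orders *)

(* Vanishing of the expansion at the primitive n-th roots of unity of the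
   element represented by f. *)
Definition flat_at (n : nat) (f : nat -> {poly int}) := forall k, exists N0,
  forall N, (N0 <= N)%N -> divides ('Phi_n ^+ k) (f N).

(* Otherwise, the leading coefficient of the expansion at a primitive m-th root
   of unity z would be divisible in Z[z] by all powers of Phi_n(z), hence of p. *)
Lemma flat_at_adjacent f p m n : coherent f -> (0 < m)%N -> (0 < n)%N ->
  m != n -> (1 < p)%N -> nilpotent_mod p n m -> flat_at n f -> flat_at m f.
Proof.
move=> f_coh m_gt0 n_gt0 neq_mn p_gt1 nil_nm flat_n.
elim=> [|k [N0 flat_k]].
  by exists 0%N => N _; exists (f N); rewrite expr0 mul1r.
have [z prim_z] := C_prim_root_exists m_gt0.
have [w prim_w] := C_prim_root_exists n_gt0.
(* From index $(k+1)m$ on, the sequence is constant modulo $\Phi_m^{k+1}$, so its quotient by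
   $\Phi_m^k$ has a fixed value at $z$. *)
exists (maxn N0 (k.+1 * m)) => N; rewrite geq_max => /andP[le_N0 le_km].
have [g gE] := flat_k N le_N0; rewrite gE exprSr.
apply: dividesM; first exact: dividesxx.
apply: (horner_Cyclotomic_divides prim_z).
apply: (in_pnZ_bigcap prim_z p_gt1) => j.
(* Every $p$ factors $\Phi_n(z)$ yield one factor $p$, hence the exponent $pj$. *)
have [N2 flat_j] := flat_n (p * j)%N.
have le_NN' := leq_maxl N N2; set N' := maxn N N2 in le_NN'.
have [g' g'E] := flat_k N' (leq_trans le_N0 le_NN').
have [v vE] : divides ('Phi_n ^+ (p * j)) g'.
  apply: (divides_Cyclotomic_exp_cancel prim_w (u := 'Phi_m ^+ k)).
    by rewrite horner_pZtoCX expf_neq0 // (Cyclotomic_root_neq0 prim_w) // eq_sym.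
  by rewrite -g'E; apply: flat_j; exact: leq_maxr.
have [h hE] : divides 'Phi_m (g' - g).
  have [h hE] := coherent_Cyclotomic_exp f_coh m_gt0 (leqW le_km) le_NN'.
  exists h; apply: (mulfI (expf_neq0 k (monic_neq0 (Cyclotomic_monic m)))).
  by rewrite mulrA -exprSr -hE gE g'E mulrBr.
have -> : (pZtoC g).[z] = (pZtoC g').[z].
  rewrite -(subrK g g') hE !horner_pZtoCE (Cyclotomic_root prim_z).
  by rewrite mul0r add0r.
have [s sE] := nil_nm z prim_z; exists (s ^+ j * v).
by rewrite vE exprM !horner_pZtoCE sE expn1 exprMn natrX mulrA.
Qed.

(** Strong induction on [k]: its least prime factor is moved over to [n], and neighbouring orders
    are linked in both directions. *)
Lemma flat_at_mul f n k : coherent f -> (0 < n)%N -> (0 < k)%N ->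
  flat_at n f <-> flat_at (n * k) f.
Proof.
move=> f_coh n_gt0; elim/ltn_ind: k n n_gt0 => k IHk n n_gt0 k_gt0.
have [-> | neq_k1] := eqVneq k 1%N; first by rewrite muln1.
have k_gt1 : (1 < k)%N by rewrite ltn_neqAle eq_sym neq_k1.
have p_pr := pdiv_prime k_gt1; set p := pdiv k in p_pr.
have p_gt1 := prime_gt1 p_pr; have p_gt0 := prime_gt0 p_pr.
have kE : k = (p * (k %/ p))%N by rewrite mulnC divnK ?pdiv_dvd.
have np_gt0 : (0 < n * p)%N by rewrite muln_gt0 n_gt0.
have neq_np : n != (n * p)%N by rewrite -{1}[n]muln1 eqn_pmul2l // neq_ltn p_gt1.
have step : flat_at n f <-> flat_at (n * p) f.
  split; apply: (@flat_at_adjacent _ p) => //; first by rewrite eq_sym.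
    exact: nilpotent_mod_up.
  exact: nilpotent_mod_down.
rewrite {1}kE mulnA; rewrite step; apply: IHk => //; first exact: ltn_Pdiv.
by rewrite divn_gt0 // dvdn_leq // pdiv_dvd.
Qed.

(** The two orders are joined through their common multiple $rs$. *)
Lemma flat_at_all f r s : coherent f -> (0 < r)%N -> (0 < s)%N ->
  flat_at r f -> flat_at s f.
Proof.
move=> f_coh r_gt0 s_gt0 /(flat_at_mul f_coh r_gt0 s_gt0); rewrite mulnC.
by move/(flat_at_mul f_coh s_gt0 r_gt0).
Qed.

Lemma flat_at_divides_qpoch f n : coherent f ->
  (forall s, (0 < s)%N -> flat_at s f) -> divides (qpoch n.+1) (f n).
Proof.
move=> f_coh f_flat; have [s s_gt0 qE] := qpoch_prod_Cyclotomic n.+1.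
(* The length of [s] bounds every multiplicity, so one exponent serves all the factors. *)
have [N0 N0P] : exists N0, forall N, (N0 <= N)%N ->
    {in s, forall a, divides ('Phi_a ^+ size s) (f N)}.
  move: (size s) => k; elim: s {qE} s_gt0 => [|a t IHt] t_gt0.
    by exists 0%N.
  have [N1 N1P] := f_flat a (t_gt0 a (mem_head _ _)) k.
  have [|N2 N2P] := IHt.
    by move=> b b_t; apply: t_gt0; rewrite in_cons b_t orbT.
  exists (maxn N1 N2) => N; rewrite geq_max => /andP[le1 le2] b.
  by rewrite in_cons => /predU1P[-> | b_t]; [exact: N1P | exact: N2P].
(* The far term [f N] is a multiple of $(q)_{n+1}$, and so is its difference from [f n]. *)
have le_nN := leq_maxr N0 n; set N := maxn N0 n in le_nN.
rewrite -(subKr (f N) (f n)); apply: dividesB; last exact: coherent_divides.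
rewrite qE; apply: divides_prod_Cyclotomic => // a a_s.
apply: divides_trans (N0P N (leq_maxl _ _) a a_s).
by apply/divides_exp2l/count_size.
Qed.

(** * Taylor expansions at roots of unity and injectivity of [iota_series] *)

Lemma comp_polyXaddC_root (z : algC) (g : {poly int}) :
  (pZtoC g \Po ('X + z%:P))`_0 = (pZtoC g).[z].
Proof. by rewrite -horner_coef0 horner_comp hornerD hornerX hornerC add0r. Qed.

(* z is a simple root of Phi_r, because it is one of X^r - 1. *)
Lemma Cyclotomic_comp_XaddC r z : r.-primitive_root z ->
  exists2 w : {poly algC}, pZtoC 'Phi_r \Po ('X + z%:P) = 'X * w & w`_0 != 0.
Proof.
move=> prim_z; have r_gt0 := prim_order_gt0 prim_z.
have [w wE] : exists w, pZtoC 'Phi_r \Po ('X + z%:P) = w * ('X - 0%:P).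
  apply/factor_theorem/rootP.
  by rewrite horner_coef0 comp_polyXaddC_root Cyclotomic_root.
rewrite subr0 mulrC in wE; exists w => //; apply/eqP => w0.
have dPhi : (pZtoC 'Phi_r)^`().[z] = 0.
  have := congr1 (fun q => q^`().[0]) wE.
  rewrite deriv_comp derivD derivX derivC addr0 mulr1.
  rewrite horner_comp hornerD hornerX hornerC add0r => ->.
  by rewrite derivM derivX mul1r hornerD hornerM hornerX mul0r addr0 horner_coef0.
have [u uE] : divides 'Phi_r ('X^r - 1 : {poly int}).
  rewrite -prod_Cyclotomic //; apply: (@divides_prod _ _ _ Cyclotomic).
  by rewrite -dvdn_divisors.
have := congr1 (fun q => (pZtoC q)^`().[z]) uE.
rewrite rmorphB rmorphM rmorph1 /= map_polyXn derivB derivXn derivC subr0 derivM.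
rewrite hornerD !hornerM dPhi Cyclotomic_root // !mul0r addr0.
rewrite hornerMn hornerXn => /eqP; rewrite mulrn_eq0 expf_eq0.
have z_neq0 : z != 0.
  apply/eqP => z0; have := prim_expr_order prim_z.
  by rewrite z0 expr0n eqn0Ngt r_gt0 => /esym/eqP; rewrite oner_eq0.
by rewrite eqn0Ngt r_gt0 (negPf z_neq0) andbF.
Qed.

(** Once $\Phi_r^k$ divides a term, its coefficient of index $k$ is a nonzero constant times the
    value of the quotient at $z$; vanishing gives one more factor $\Phi_r$. *)
Lemma flat_at_coef f r z : coherent f -> r.-primitive_root z ->
  (forall k, (pZtoC (f (k.+1 * r)%N) \Po ('X + z%:P))`_k = 0) -> flat_at r f.
Proof.
move=> f_coh prim_z f0; have r_gt0 := prim_order_gt0 prim_z.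
move=> k; exists (k * r)%N; elim: k => [|k IHk] N le_N.
  by exists (f N); rewrite expr0 mul1r.
have [w wE w0_neq0] := Cyclotomic_comp_XaddC prim_z.
rewrite -(subrK (f (k.+1 * r)%N) (f N)); apply: dividesD.
  exact: coherent_Cyclotomic_exp.
have [|g gE] := IHk (k.+1 * r)%N; first by rewrite leq_mul2r leqnSn orbT.
rewrite gE exprSr; apply: dividesM; first exact: dividesxx.
apply: (horner_Cyclotomic_divides prim_z).
have := f0 k; rewrite gE rmorphM rmorphXn /= comp_polyM rmorphXn /= wE.
rewrite exprMn -mulrA coefXnM ltnn subnn -!horner_coef0 hornerM horner_exp.
rewrite !horner_coef0 comp_polyXaddC_root => /eqP.
by rewrite mulf_eq0 expf_eq0 (negPf w0_neq0) andbF => /eqP.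
Qed.

Lemma level_coherent (J : habiro_ring) n :
  divides (qpoch n.+1) ((level J n.+1 : {poly int}) - level J n).
Proof.
case: J => l lE /=.
(* [in_qpoly] divides by [mk_monic] of $(q)_{n+1}$, which is $(q)_{n+1}$ itself. *)
have -> : (l n : {poly int}) = rmodp (l n.+1) (qpoch n.+1).
  by rewrite lE /= (mk_monic_qpoch n).
rewrite {1}(Pdiv.RingMonic.rdivp_eq (qpoch_monic n.+1) (l n.+1)) addrK.
by rewrite mulrC; apply/divides_mulr/dividesxx.
Qed.

Lemma size_level (J : habiro_ring) n :
  (size (level J n : {poly int}) < size (qpoch n.+1))%N.
Proof. by rewrite -{2}mk_monic_qpoch size_mk_monic. Qed.

Lemma eq_habiro (J J' : habiro_ring) :
  (forall n, (level J n : {poly int}) = level J' n) -> J = J'.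
Proof.
case: J J' => [l lE] [l' l'E] /= eq_l.
have eq_ll' : l = l'.
  by apply: functional_extensionality_dep => n; apply: val_inj; exact: eq_l.
by subst l'; congr HabiroRing; exact: Prop_irrelevance.
Qed.

Lemma iota_series_inj r z (J J' : habiro_ring) : r.-primitive_root z ->
  iota_series r z J = iota_series r z J' -> J = J'.
Proof.
move=> prim_z eq_iota; have r_gt0 := prim_order_gt0 prim_z.
pose f n : {poly int} := (level J n : {poly int}) - level J' n.
have f_coh : coherent f.
  move=> n; have -> : f n.+1 - f n =
    ((level J n.+1 : {poly int}) - level J n)
    - ((level J' n.+1 : {poly int}) - level J' n).
    by rewrite /f; ring.
  by apply: dividesB; exact: level_coherent.
have f_flat s : (0 < s)%N -> flat_at s f.
  move=> s_gt0; apply: (flat_at_all f_coh r_gt0 s_gt0).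
  apply: (flat_at_coef f_coh prim_z) => k.
  have := congr1 (fun u : nat -> algC => u k) eq_iota; rewrite /iota_series => eq_k.
  by rewrite rmorphB comp_polyB coefB eq_k subrr.
apply: eq_habiro => n; apply/eqP; rewrite -subr_eq0; apply/eqP.
(* The levels are reduced representatives, so divisibility by $(q)_{n+1}$ forces equality. *)
apply: (monic_divides_small (qpoch_monic n.+1)).
  exact: (flat_at_divides_qpoch n f_coh f_flat).
rewrite (leq_ltn_trans (size_polyD _ _)) // size_polyN gtn_max.
by rewrite !size_level.
Qed.

(** * The Ohtsuki series as the expansion at $q=1$ *)

Lemma sum_take_drop_horner (h : {poly int}) m (x : algC) :
  (pZtoC h).[x] =
    \sum_(k < m) (h`_k)%:~R * x ^+ k + x ^+ m * (pZtoC (drop_poly m h)).[x].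
Proof.
rewrite -{1}(poly_take_drop m h) horner_pZtoCD horner_pZtoCM addrC [_ * _]mulrC.
rewrite map_polyXn hornerXn addrC; congr (_ + _).
have sz : (size (pZtoC (take_poly m h)) <= m)%N.
  by rewrite (leq_trans (size_poly _ _)) // size_take_poly.
rewrite (horner_coef_wide _ sz); apply: eq_bigr => k _.
by rewrite coef_map coef_take_poly ltn_ord.
Qed.

Lemma level_ev (J : habiro_ring) r z n : r.-primitive_root z -> (r <= n)%N ->
  ev r z J = (pZtoC (level J n)).[z].
Proof.
move=> prim_z le_rn; have r_gt0 := prim_order_gt0 prim_z.
apply/esym/eqP; rewrite -subr_eq0 -hornerN -hornerD -rmorphB; apply/eqP.
apply: (divides_horner_Cyclotomic prim_z); rewrite -[X in divides X]expr1.
apply: (coherent_Cyclotomic_exp (level_coherent J)) => //.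
by rewrite mul1n.
Qed.

Definition series_at1 (J : habiro_ring) (k : nat) : int :=
  ((level J k.+1 : {poly int}) \Po ('X + 1))`_k.

Lemma series_at1E J k : (series_at1 J k)%:~R = iota_series 1 1 J k.
Proof.
rewrite /iota_series muln1 /series_at1.
by rewrite -coef_map /= map_comp_poly rmorphD /= map_polyX rmorph1.
Qed.

(** Levels from $k+1$ on differ by multiples of $(q-1)^{k+1}$, which do not affect the coefficient
    of index $k$. *)
Lemma series_at1_level J k n : (k <= n)%N ->
  ((level J n.+1 : {poly int}) \Po ('X + 1))`_k = series_at1 J k.
Proof.
move=> le_kn; rewrite /series_at1; apply/eqP; rewrite -subr_eq0 -coefB -comp_polyB.
have [|||w ->] := @coherent_Cyclotomic_exp _ 1 k.+1 k.+1 n.+1 (level_coherent J) => //.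
  by rewrite muln1.
rewrite Cyclotomic1 comp_polyM rmorphXn /= comp_polyB comp_polyX comp_polyC.
by rewrite polyC1 addrK coefXnM ltnS leqnn.
Qed.

Lemma XsubC1_expp_horner (p e : nat) z : prime p -> odd p ->
  (p ^ e)%N.-primitive_root z -> in_pnZ p 1 z ((z - 1) ^+ (p ^ e)).
Proof.
move=> p_pr p_odd prim_z; have [h hE] := XsubC1_expp_modp e p_pr p_odd.
exists h; move: (congr1 (fun q => (pZtoC q).[z]) hE).
rewrite !horner_pZtoCE.
by rewrite (prim_expr_order prim_z) !subrr subr0 expn1.
Qed.

Lemma ohtsuki_series_at1 (R : realType) (M : homology_sphere3 R) J :
  is_unified_wrt M J -> is_ohtsuki_series M (series_at1 J).
Proof.
move=> hJ p e z p_pr p_odd e_gt0 prim_z n; set q := (p ^ e)%N in prim_z *.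
(* Every [q] factors $z-1$ supply one factor $p$, so the tail from index [q * n] on lies in
   $p^n\mathbb Z[z]$. *)
exists (q * n)%N => m le_m; have [s sE] := XsubC1_expp_horner p_pr p_odd prim_z.
rewrite -(hJ q z prim_z).
(* The level must be at least [q] to evaluate at [z], and large enough for the first [m]
   coefficients to be final. *)
rewrite (level_ev J prim_z (leqW (leq_maxr m q))); set N := maxn m q.
set L := (level J N.+1 : {poly int}).
have -> : (pZtoC L).[z] = (pZtoC (L \Po ('X + 1))).[z - 1].
  by rewrite horner_pZtoC_comp !horner_pZtoCE subrK.
rewrite (sum_take_drop_horner _ m) opprD addrA.
set S := \sum_(k < m) _; set S' := \sum_(k < m) _.
have -> : S = S'.
  apply: eq_bigr => k _; rewrite series_at1_level //.
  by rewrite (leq_trans (ltnW (ltn_ord k))) ?leq_maxl.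
rewrite subrr add0r; set D := drop_poly _ _.
exists (- (s ^+ n * ('X - 1) ^+ (m - q * n) * (D \Po ('X - 1)))).
rewrite horner_pZtoCN mulrN; congr (- _).
rewrite -{1}(subnKC le_m) exprD exprM sE expn1 exprMn natrX.
by rewrite !horner_pZtoCE horner_pZtoC_comp !horner_pZtoCE !mulrA.
Qed.

(** * Uniqueness of the Ohtsuki series *)

Lemma Cyclotomic_prime_horner1 (p : nat) : prime p -> ('Phi_p).[1] = p%:R :> int.
Proof.
move=> p_pr; have p_gt0 := prime_gt0 p_pr.
have := comp_Cyclotomic_ndvd (n := 1) p_pr isT.
rewrite dvdn1 mul1n Cyclotomic1 comp_polyB comp_polyX comp_polyC => /(_ _).
rewrite neq_ltn prime_gt1 ?orbT // => /(_ isT); rewrite mulrC polyC1.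
rewrite subrX1 => /mulfI <- //; last by rewrite -polyC1 polyXsubC_eq0.
rewrite horner_sum (eq_bigr (fun=> 1)) ?sumr_const ?card_ord //.
by move=> i _; rewrite hornerXn expr1n.
Qed.

(* p is z - 1 times an element of Z[z] when z has order p, and (z - 1) Z[z]
   meets Z in p Z. *)
Lemma ohtsuki_coef_dvd (p : nat) (z : algC) (d : nat -> int) k : prime p ->
  p.-primitive_root z -> (forall j, (j < k)%N -> d j = 0) ->
  (exists2 m, (k < m)%N &
     in_pnZ p k.+1 z (\sum_(j < m) (d j)%:~R * (z - 1) ^+ j)) ->
  (p %| d k)%Z.
Proof.
move=> p_pr prim_z d0 [m lt_km [g gE]].
have Phi1 := Cyclotomic_prime_horner1 p_pr.
have [u uE] : exists u : {poly int}, 'Phi_p = u * ('X - 1) + p%:R.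
  have /factor_theorem[u uE] : root ('Phi_p - p%:R) (1 : int).
    by rewrite /root hornerD hornerN hornerMn hornerC Phi1 subrr.
  by exists u; rewrite -uE subrK.
have pE : p%:R = (z - 1) * (pZtoC (- u)).[z].
  have := Cyclotomic_root prim_z; rewrite uE !horner_pZtoCE.
  move/eqP; rewrite addr_eq0 => /eqP pE.
  by rewrite mulrN mulrC pE opprK.
have z1_neq0 : z - 1 != 0.
  have := Cyclotomic_root_neq0 prim_z (isT : 0 < 1)%N.
  by rewrite Cyclotomic1 !horner_pZtoCE; apply; rewrite neq_ltn prime_gt1 ?orbT.
pose r : {poly int} := \sum_(j < m - k.+1) (d (k.+1 + j)%N)%:P * ('X - 1) ^+ j.
have sumE : \sum_(j < m) (d j)%:~R * (z - 1) ^+ j =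
    (z - 1) ^+ k * ((d k)%:~R + (z - 1) * (pZtoC r).[z]).
  rewrite -(big_mkord xpredT (fun j => (d j)%:~R * (z - 1) ^+ j)).
  rewrite (big_cat_nat (n := k.+1)) //= big_nat_recr //= big1_seq; last first.
    by move=> j; rewrite mem_index_iota => /andP[_ lt_jk]; rewrite d0 // mul0r.
  rewrite add0r mulrDr [X in X + _]mulrC; congr (_ + _).
  rewrite mulrA -exprSr -{1}(add0n k.+1) big_addn big_mkord.
  rewrite /r rmorph_sum horner_sum mulr_sumr; apply: eq_bigr => j _.
  by rewrite !horner_pZtoCE addnC exprD mulrCA.
(* The factor $p^{k+1}$ provides $k+1$ factors $z-1$, one more than the $k$ to be cancelled. *)
have dE : (d k)%:~R + (z - 1) * (pZtoC r).[z] =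
    (z - 1) * (pZtoC ((- u) ^+ k.+1 * g)).[z].
  apply: (mulfI (expf_neq0 k z1_neq0)); rewrite -sumE gE natrX pE exprMn !horner_pZtoCE.
  by rewrite exprSr !mulrA.
have [w wE] : divides 'Phi_p ((d k)%:P + ('X - 1) * (r - (- u) ^+ k.+1 * g)).
  apply: (horner_Cyclotomic_divides prim_z).
  rewrite mulrDr addrA !horner_pZtoCE.
  by move: dE; rewrite !horner_pZtoCE => ->; rewrite mulrN subrr.
(* Evaluation at $q=1$ kills the multiples of $q-1$ and turns $\Phi_p$ into $p$. *)
have X1 : ('X - 1 : {poly int}).[1] = 0 by rewrite !hornerE subrr.
have := congr1 (fun q => q.[1]) wE.
rewrite hornerD hornerC !hornerM X1 mul0r addr0 Phi1 => ->.
by rewrite natz dvdz_mulr.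
Qed.

Lemma ohtsuki_series_unique (R : realType) (M : homology_sphere3 R) P Q :
  is_ohtsuki_series M P -> is_ohtsuki_series M Q -> P = Q.
Proof.
move=> hP hQ; apply: functional_extensionality_dep => k.
apply/eqP; rewrite -subr_eq0.
pose d j := P j - Q j; rewrite -[_ - _]/(d k); apply/eqP.
elim/ltn_ind: k => k d0.
have dk_dvd (p : nat) : prime p -> odd p -> (p %| d k)%Z.
  move=> p_pr p_odd; have [z prim_z] := C_prim_root_exists (prime_gt0 p_pr).
  have prim_z' : (p ^ 1)%N.-primitive_root z by rewrite expn1.
  (* Precision $p^{k+1}$ at roots of order $p$ suffices to isolate the coefficient of index $k$. *)
  have [N NP] := hP p 1%N z p_pr p_odd isT prim_z' k.+1.
  have [N' NP'] := hQ p 1%N z p_pr p_odd isT prim_z' k.+1.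
  apply: (ohtsuki_coef_dvd p_pr prim_z d0).
  pose m := maxn k.+1 (maxn N N'); exists m; first exact: leq_maxl.
  have [|g gE] := NP m; first by rewrite /m maxnCA leq_maxl.
  have [|g' g'E] := NP' m; first by rewrite /m [maxn N N']maxnC maxnCA leq_maxl.
  exists (g - g'); rewrite !horner_pZtoCE mulrDr mulrN -gE -g'E opprB addrA subrK.
  by rewrite -sumrB; apply: eq_bigr => j _; rewrite rmorphB mulrBl.
(* A nonzero integer has no divisor above its absolute value; the bound 2 makes the prime odd. *)
have [p lt_p p_pr] := prime_above (maxn 2 (absz (d k))).
move: lt_p; rewrite gtn_max => /andP[p_gt2 lt_p].
have p_odd : odd p by case: (even_prime p_pr) p_gt2 => [-> |].
have := dk_dvd p p_pr p_odd; rewrite dvdzE absz_nat.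
have [// | dk_neq0] := eqVneq (d k) 0; rewrite -absz_gt0 in dk_neq0.
by move=> /(dvdn_leq dk_neq0); rewrite leqNgt lt_p.
Qed.

(** [ohtsuki] is a choice with a default value: existence makes it a genuine Ohtsuki series, and
    uniqueness identifies it. *)
Lemma ohtsukiE (R : realType) (M : homology_sphere3 R) J :
  is_unified_wrt M J -> ohtsuki M = series_at1 J.
Proof.
move=> hJ; have J_oht := ohtsuki_series_at1 hJ.
apply: (ohtsuki_series_unique (M := M)) => //.
by apply: xgetPex; exists (series_at1 J).
Qed.

Theorem mainTheorem4 (R : realType) (M M' : homology_sphere3 R)
    (J J' : habiro_ring) (hJ : is_unified_wrt M J) (hJ' : is_unified_wrt M' J') :
  [/\ forall (r : nat) (z : algC), r.-primitive_root z ->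
        iota_series r z J = iota_series r z J' ->
        J = J' /\
        (forall (s : nat) (xi : algC), s.-primitive_root xi ->
           wrt M s xi = wrt M' s xi),
      ohtsuki M = ohtsuki M' -> J = J' &
      J = J' <-> ohtsuki M = ohtsuki M'].
Proof.
have ohtsuki_inj : ohtsuki M = ohtsuki M' -> J = J'.
  rewrite (ohtsukiE hJ) (ohtsukiE hJ') => eq_PP'.
  apply: (iota_series_inj (z := 1) (r := 1)).
    apply/andP; split=> //; apply/forallP => i.
    by rewrite (ord1 i) unity_rootE expr1n eqxx.
  by apply: functional_extensionality_dep => k; rewrite -!series_at1E eq_PP'.
split=> // [r z prim_z /(iota_series_inj prim_z) eq_JJ'|].
  split=> // s xi prim_xi; rewrite -(hJ s xi prim_xi) -(hJ' s xi prim_xi).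
  by rewrite eq_JJ'.
split=> // eq_JJ'; rewrite (ohtsukiE hJ) (ohtsukiE hJ').
by rewrite eq_JJ'.
Qed.
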